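(* Any geodesic of the two-dimensional disk (with flat metric) satisfies (GRC), i.e. satisfies (GRC) for every $\varepsilon>0$; but the two-dimensional disk with flat metric does not satisfy the dichotomy property.
   Context: Let $M$ be the two-dimensional Euclidean disk (a compact manifold with boundary) with flat metric $g$. Geodesics are generalized geodesics traveled at speed $1$: the projections onto $M$, parametrized by time $t\in\mathbb{R}$, of the generalized bicharacteristics of Melrose and Sjöstrand; they are straight lines traveled at speed $1$ inside the disk and reflect on the boundary circle according to the laws of geometric optics. (GRC) for $\varepsilon>0$: a generalized geodesic $t\mapsto y(t)$ satisfies (GRC) for $\varepsilon$ if there exists an open ball $U\subset M$ (depending on $y(\cdot)$) of radius $<\varepsilon$ such that $$\liminf_{T\to+\infty}\frac{|\{t\in[0,T]\mid y(t)\in U\}|}{T}>0.$$ Dichotomy property: $(M,g)$ satisfies the dichotomy property if each of its geodesics $t\mapsto y(t)$ is either periodic or uniformly distributed, the latter meaning that for every open set $U\subset M$, $$\lim_{T\to+\infty}\frac{|\{t\in[0,T]\mid y(t)\in U\}|}{T}=\frac{\mathrm{vol}_g(U)}{\mathrm{vol}_g(M)}.$$ Here $|A|$ is the Lebesgue measure of a measurable set $A\subset\mathbb{R}$. *)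

(* Defs.v *)
From HB Require Import structures.
From mathcomp Require Import all_boot all_order all_algebra.
From mathcomp Require Import all_classical all_reals all_analysis.

Set Implicit Arguments.
Unset Strict Implicit.
Unset Printing Implicit Defensive.
Import Order.TTheory GRing.Theory Num.Theory.
Import numFieldNormedType.Exports.
Local Open Scope classical_set_scope.
Local Open Scope ring_scope.

Definition dot {R : realType} (p q : R * R) : R := p.1 * q.1 + p.2 * q.2.

(* The norm that the library puts on [R * R] is the max norm. *)
Definition enorm {R : realType} (p : R * R) : R := Num.sqrt (dot p p).

Definition disk {R : realType} (r : R) : set (R * R) := [set p | enorm p <= r].

(* [(y, v)] is a generalized bicharacteristic of Melrose and Sjostrand of the
   disk of radius [r], in time parametrization: the covector [v] is identified
   with the velocity by the flat metric, so that p = (|v|^2 - 1) / 2.  At each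
   time, the point is of one of the following kinds.
   - Interior: (y, v) follows the Hamiltonian field H_p = (v, 0).
   - Glancing: (y, v) follows the gliding field
       H_p^G = H_p + (H_p^2 phi / H_phi^2 p) H_phi,
     where phi = (r^2 - |y|^2) / 2 is a boundary defining function.  Since
     H_p^2 phi = - |v|^2 = - 1 < 0, no glancing point is diffractive; since
     H_phi = (0, y) and H_phi^2 p = r^2, the field is (v, - y / r^2).
   - Hyperbolic: the time is isolated among those spent on the boundary and v
     jumps between the two points of the fibre, i.e. it is reflected by the
     tangent line.  At such times v denotes the outgoing velocity. *)
Definition generalized_bicharacteristic {R : realType} (r : R)
    (y v : R -> R * R) : Prop :=
  [/\ continuous y,
      (forall t, disk r (y t)),
      (forall t, enorm (v t) = 1) &
      forall t,
        [\/ [/\ enorm (y t) < r, is_derive t 1 y (v t) & is_derive t 1 v 0],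
            [/\ enorm (y t) = r, dot (y t) (v t) = 0, is_derive t 1 y (v t)
              & is_derive t 1 v (- (r ^- 2 *: y t))]
          | [/\ enorm (y t) = r, (\forall s \near t^', enorm (y s) < r)
              & exists w : R * R,
                [/\ dot (y t) w != 0, v s @[s --> t^'-] --> w,
                    v s @[s --> t^'+] --> v t
                  & v t = w - (2 * dot (y t) w / r ^+ 2) *: y t]]]].

Definition generalized_geodesic {R : realType} (r : R) (y : R -> R * R) : Prop :=
  exists v, generalized_bicharacteristic r y v.

Definition occupation {R : realType} (y : R -> R * R) (U : set (R * R)) (T : R)
    : \bar R :=
  (lebesgue_measure [set t : R | 0 <= t <= T /\ U (y t)]%R / T%:E)%E.

(* Balls of the metric space [disk r]: they may be centred on the boundary and
   are the traces on the disk of planar balls. *)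
Definition disk_ball {R : realType} (r : R) (c : R * R) (rho : R)
    : set (R * R) :=
  [set p | disk r p /\ enorm (p - c) < rho].

Definition GRC {R : realType} (r : R) (y : R -> R * R) (eps : R) : Prop :=
  exists (c : R * R) (rho : R),
    [/\ disk r c, 0 < rho < eps
      & (0 < limf_einf (occupation y (disk_ball r c rho)) (pinfty_nbhs R))%E].

Definition disk_open {R : realType} (r : R) (U : set (R * R)) : Prop :=
  exists2 O : set (R * R), open O & U = disk r `&` O.

Definition area {R : realType} (U : set (R * R)) : \bar R :=
  (lebesgue_measure \x lebesgue_measure)%E U.

Definition periodic_curve {R : realType} (y : R -> R * R) : Prop :=
  exists2 P : R, 0 < P & forall t, y (t + P) = y t.

Definition uniformly_distributed {R : realType} (r : R) (y : R -> R * R)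
    : Prop :=
  forall U, disk_open r U ->
    occupation y U T @[T --> +oo] --> (area U / area (disk r))%E.

Definition dichotomy {R : realType} (r : R) : Prop :=
  forall y, generalized_geodesic r y ->
    periodic_curve y \/ uniformly_distributed r y.

(* Main.v *)
(* At a transversal hit of the boundary, the inner product of position and
   outgoing velocity and their cross product take the same values as at the
   previous hit.  Hence consecutive hits are separated by a constant time and
   related by a fixed linear isometry, and an orbit of an isometry in a bounded
   set returns with bounded gaps near its starting point.  If no hit is
   transversal then the curve glides along the circle with constant speed and
   is periodic.

   Against the dichotomy, we follow the chord at distance 4r/5 from the center.
   Consecutive hits differ by the rotation (7 + 24 i) / 25, which is not a root
   of unity, so the curve is not periodic; and it never enters the square of
   half-side r/2 about the center. *)

Require Import Defs.
From mathcomp Require Import all_boot all_order all_algebra.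
From mathcomp Require Import all_classical all_reals all_analysis.
From mathcomp Require Import measurable_realfun zify lra ring.
Import Order.TTheory GRing.Theory Num.Theory.
Import numFieldNormedType.Exports.
Local Open Scope classical_set_scope.
Local Open Scope ring_scope.

(** * Euclidean norm on the plane, and functions with vanishing derivative *)

Section EuclideanNorm.
Context {R : realType}.
Implicit Types (p q : R * R) (r : R) (y : R -> R * R).

Lemma scale_pairE r p : r *: p = (r * p.1, r * p.2).
Proof. by []. Qed.

Lemma enorm_ge0 p : 0 <= enorm p.
Proof. exact: sqrtr_ge0. Qed.

Lemma enorm_sqr p : enorm p ^+ 2 = p.1 ^+ 2 + p.2 ^+ 2.
Proof. by rewrite /enorm /dot sqr_sqrtr -?expr2 ?addr_ge0 ?sqr_ge0. Qed.

Lemma enorm_lt p r : 0 <= r -> (enorm p < r) = (p.1 ^+ 2 + p.2 ^+ 2 < r ^+ 2).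
Proof. by move=> r0; rewrite -enorm_sqr ltr_pXn2r// nnegrE ?enorm_ge0. Qed.

Lemma enorm_le p r : 0 <= r -> (enorm p <= r) = (p.1 ^+ 2 + p.2 ^+ 2 <= r ^+ 2).
Proof. by move=> r0; rewrite -enorm_sqr ler_pXn2r// nnegrE ?enorm_ge0. Qed.

Lemma enorm_eq p r : 0 <= r -> (enorm p == r) = (p.1 ^+ 2 + p.2 ^+ 2 == r ^+ 2).
Proof. by move=> r0; rewrite -enorm_sqr eqrXn2// enorm_ge0. Qed.

Lemma enormD p q : enorm (p + q) <= enorm p + enorm q.
Proof.
rewrite enorm_le ?addr_ge0 ?enorm_ge0//= [leRHS]sqrrD !enorm_sqr.
(* What remains is the Cauchy-Schwarz inequality: a nonpositive inner product is immediate, and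
   otherwise the squares of the two sides differ by the square of the cross product. *)
suff : p.1 * q.1 + p.2 * q.2 <= enorm p * enorm q by nra.
have [|/ltW pq0] := leP (p.1 * q.1 + p.2 * q.2) 0.
  by move=> /le_trans; apply; rewrite mulr_ge0 ?enorm_ge0.
rewrite -(@ler_pXn2r _ 2%N)// ?nnegrE ?mulr_ge0 ?enorm_ge0//.
rewrite exprMn !enorm_sqr; have := sqr_ge0 (p.1 * q.2 - p.2 * q.1); nra.
Qed.

Lemma enormZ r p : enorm (r *: p) = `|r| * enorm p.
Proof.
apply/eqP; rewrite enorm_eq ?mulr_ge0 ?enorm_ge0//=; apply/eqP.
rewrite [RHS]exprMn enorm_sqr real_normK ?num_real//=.
by rewrite /GRing.scale/=; ring.
Qed.

Lemma continuous_enorm : continuous (@enorm R).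
Proof.
move=> p; apply: continuous_comp; last exact: sqrt_continuous.
by apply: cvgD; apply: cvgM; (exact: cvg_fst || exact: cvg_snd).
Qed.

Lemma is_derive_comp_fst (y : R -> R * R) (t : R) (w : R * R) :
  is_derive t 1 y w -> is_derive t 1 (fst \o y) w.1.
Proof.
move=> [ex E].
have L : h^-1 *: ((fst \o y) (h *: 1 + t) - (fst \o y) t) @[h --> 0^'] --> w.1.
  rewrite -E /derive.
  pose f h := h^-1 *: ((y \o shift t) (h *: 1) - y t).
  have := @cvg_comp _ _ _ f fst (0^') _ _ ex.
  by apply; exact: cvg_fst.
by split; [apply/cvg_ex; exists w.1|exact: cvg_lim L].
Qed.

Lemma is_derive_comp_snd (y : R -> R * R) (t : R) (w : R * R) :
  is_derive t 1 y w -> is_derive t 1 (snd \o y) w.2.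
Proof.
move=> [ex E].
have L : h^-1 *: ((snd \o y) (h *: 1 + t) - (snd \o y) t) @[h --> 0^'] --> w.2.
  rewrite -E /derive.
  pose f h := h^-1 *: ((y \o shift t) (h *: 1) - y t).
  have := @cvg_comp _ _ _ f snd (0^') _ _ ex.
  by apply; exact: cvg_snd.
by split; [apply/cvg_ex; exists w.2|exact: cvg_lim L].
Qed.

Lemma derive0_cst_cc (f : R -> R) (a b : R) : {within `[a, b], continuous f} ->
  (forall t, a < t < b -> is_derive t 1 f 0) ->
  forall t, a <= t <= b -> f t = f a.
Proof.
move=> cf df t /andP[at_ tb].
have [c| |c _] := @MVT_segment R f (cst 0) a t at_.
- by rewrite in_itv/= => /andP[sc ct]; apply: df; lra.
- apply: continuous_subspaceW cf => c /=; rewrite !in_itv/=; lra.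
- by rewrite /cst mul0r => /eqP; rewrite subr_eq0 => /eqP.
Qed.

Lemma derive0_cst_oo (f : R -> R) (a b : R) :
  (forall t, a < t < b -> is_derive t 1 f 0) ->
  forall s t, a < s < b -> a < t < b -> f s = f t.
Proof.
move=> df.
suff H s t : a < s < b -> a < t < b -> s <= t -> f t = f s.
  by move=> s t ? ?; have [|/ltW] := leP s t => ?; [symmetry|]; exact: H.
move=> /andP[as_ sb] /andP[at_ tb] st.
apply: (@derive0_cst_cc f s t); [|by move=> c ?; apply: df; lra|by rewrite st/=].
apply: derivable_within_continuous => c; rewrite in_itv/= => ?.
by have [] := df c ltac:(lra).
Qed.

End EuclideanNorm.

(** * Recurrence of isometric orbits *)

Section Recurrence.
Context {R : realType}.
Implicit Types (r e : R) (y : R -> R * R) (z : nat -> R * R).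

(** Colours are the cells of a grid of side [e / 2], whose diameter is less than [e]. The shift by
    [r] makes the coordinates nonnegative, and [2 * (x + r) / e] is at most [4 * r / e], which
    bounds the number of cells. *)
Lemma disk_coloring r e : 0 <= r -> 0 < e ->
  exists N (c : R * R -> 'I_N.+1 * 'I_N.+1),
    forall p q, disk r p -> disk r q -> c p = c q -> enorm (p - q) < e.
Proof.
move=> r0 e0.
pose k (x : R) := Num.truncn (2 * (x + r) / e).
pose N := Num.truncn (4 * r / e).
have coordP (p : R * R) : disk r p -> `|p.1| <= r /\ `|p.2| <= r.
  rewrite /disk/= enorm_le// => pr; split.
    rewrite -(@ler_pXn2r _ 2%N)// ?nnegrE// real_normK ?num_real//.
    by rewrite (le_trans _ pr)// lerDl sqr_ge0.
  rewrite -(@ler_pXn2r _ 2%N)// ?nnegrE// real_normK ?num_real//.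
  by rewrite (le_trans _ pr)// lerDr sqr_ge0.
have kP x : `|x| <= r -> (k x < N.+1)%N.
  rewrite ler_norml => /andP[x1 x2]; rewrite ltnS /k /N.
  apply: le_truncn; rewrite ler_pM2r ?invr_gt0//; lra.
have kE x x' : `|x| <= r -> `|x'| <= r -> k x = k x' -> `|x - x'| < e / 2.
  rewrite !ler_norml => /andP[x1 x2] /andP[x'1 x'2] kxx.
  have h0 a : - r <= a -> 0 <= 2 * (a + r) / e.
    by move=> ar; rewrite divr_ge0 ?(ltW e0)//; lra.
  have /andP := truncn_itv (h0 _ x1); have /andP := truncn_itv (h0 _ x'1).
  rewrite -/(k x) -/(k x') kxx -(natr1 (k x')).
  rewrite !ler_pdivlMr// !ltr_pdivrMr// => -[u1 u2] [u3 u4].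
  by rewrite ltr_norml; apply/andP; split; lra.
exists N, (fun p => (inord (k p.1), inord (k p.2))) => p q pr qr [].
have [p1 p2] := coordP _ pr; have [q1 q2] := coordP _ qr.
move=> /(congr1 val) + /(congr1 val); rewrite /= !inordK ?kP//.
move=> /(kE _ _ p1 q1) pq1 /(kE _ _ p2 q2) pq2.
rewrite enorm_lt ?ltW//=.
have sq x : `|x| < e / 2 -> x ^+ 2 < e ^+ 2 / 4.
  by rewrite ltr_norml => /andP[x1 x2]; nra.
have := sq _ pq1; have := sq _ pq2; nra.
Qed.

(* A colour visited at all is first visited at a time bounded by M, because
   there are finitely many colours.  Hence z (n + M) is close to some z k with
   k <= M, and by the isometry z (n + M - k) is close to z 0. *)
Lemma isometric_orbit_recurrent r z e : 0 <= r -> 0 < e ->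
  (forall n, disk r (z n)) ->
  (forall k m n, enorm (z (m + k)%N - z (n + k)%N) = enorm (z m - z n)) ->
  exists M, forall n, exists2 m, (n <= m <= n + M)%N & enorm (z m - z 0%N) < e.
Proof.
move=> r0 e0 zr iso.
have [N [c cP]] := disk_coloring _ _ r0 e0.
have /choice[f fP] (k : 'I_N.+1 * 'I_N.+1) :
    exists n, forall m, c (z m) = k -> c (z n) = k.
  have [[n <-]|nk] := pselect (exists n, c (z n) = k); first by exists n.
  by exists 0%N => m ck; exfalso; apply: nk; exists m.
exists (\max_k f k) => n; set M := (\max_k f k)%N.
set k := c (z (n + M)%N).
have fM : (f k <= M)%N by exact: leq_bigmax.
exists (n + M - f k)%N; first by apply/andP; split; lia.
rewrite -(iso (f k)) add0n subnK; last lia.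
by apply: cP => //; rewrite (fP k (n + M)%N).
Qed.

Lemma limf_einf_ge (f : R -> \bar R) (T0 : R) (k : \bar R) :
  (forall T, T0 < T -> (k <= f T)%E) -> (k <= limf_einf f (pinfty_nbhs R))%E.
Proof.
move=> kf; rewrite limf_einfE.
apply: le_trans (ereal_sup_ubound _); last first.
  exists [set T | T0 < T] => //; exists T0; split => //; exact: num_real.
by apply: le_ereal_inf_tmp => _ [T /= T0T <-]; exact: kf.
Qed.

(** The stays lie in disjoint windows of length [q], so their lengths add up: by time [b + q * n]
    the curve has spent at least [n * d] in the ball. *)
Lemma GRC_returns r y (c : R * R) (rho eps b q d : R) :
  continuous y -> (forall t, disk r (y t)) -> disk r c -> 0 < rho < eps ->
  0 <= b -> 0 < d -> 0 < q ->
  (forall n : nat, exists s, [/\ b + q * n%:R <= s, s + d <= b + q * n.+1%:R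
     & forall t, s <= t < s + d -> enorm (y t - c) < rho]) ->
  GRC r y eps.
Proof.
move=> cy yr cr re b0 d0 q0 H; exists c, rho; split => //.
pose U := [set t | enorm (y t - c) < rho].
have mU : measurable U.
  apply: open_measurable; rewrite /U.
  have -> : [set t | enorm (y t - c) < rho]
      = (fun t => enorm (y t - c)) @^-1` [set x | x < rho] by [].
  apply: open_comp; last exact: open_lt.
  move=> t _; apply: (@continuous_comp _ _ _ (fun t => y t - c) (@enorm R)).
    by apply: cvgB; [exact: cy|exact: cvg_cst].
  exact: continuous_enorm.
have count (n : nat) :
    ((n%:R * d)%:E <= lebesgue_measure (`[0%R, (b + q * n%:R)%R[ `&` U))%E.
  elim: n => [|n IH]; first by rewrite mul0r measure_ge0.
  have [s [s1 s2 s3]] := H n.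
  apply: (@le_trans _ _ (lebesgue_measure
     ((`[0%R, (b + q * n%:R)%R[ `&` U) `|` `[s, s + d[%classic))); last first.
    apply: le_measure; rewrite ?inE.
    - by apply: measurableU => //; exact: measurableI.
    - exact: measurableI.
    - move=> t [|]/=; rewrite !in_itv/=.
        move=> [/andP[t1 t2] Ut]; split => //; rewrite t1/=.
        by rewrite (lt_le_trans t2)// lerD2l ler_pM2l// ler_nat.
      move=> /[dup] /andP[t1 t2] /s3 Ut; split => //; apply/andP; split; last lra.
      have : 0 <= q * n%:R by rewrite mulr_ge0// ltW.
      lra.
  rewrite measureU//; last 2 first.
  - exact: measurableI.
  - rewrite -subset0 => t [[/=]]; rewrite !in_itv/= => /andP[t1 t2] _.
    by move=> /andP[t3 t4]; lra.
  have dE : lebesgue_measure (`[s, s + d[%classic : set R) = d%:E.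
    by rewrite lebesgue_measure_itv/= lte_fin ltrDl d0 -EFinD addrAC subrr add0r.
  by rewrite -(natr1 n) mulrDl mul1r EFinD; apply: leeD; [exact: IH|rewrite -dE].
(* Half of the density [d / q] is given up to absorb the offset [b] and the last incomplete window:
   for [T > 2 * b + 2 * q], the complete windows cover more than [T / 2]. *)
apply: (@lt_le_trans _ _ (d / (2 * q))%:E).
  by rewrite lte_fin divr_gt0// mulr_gt0.
apply: (@limf_einf_ge _ (2 * b + 2 * q)) => T bT.
have T0 : 0 < T by lra.
rewrite /occupation inver gt_eqF// lee_pdivlMr//.
set n := Num.truncn ((T - b) / q).
have /andP[n1 n2] : n%:R <= (T - b) / q < n.+1%:R.
  by apply: truncn_itv; rewrite divr_ge0 ?(ltW q0)//; lra.
move: n1 n2; rewrite ler_pdivlMr// ltr_pdivrMr// -(natr1 n) => n1 n2.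
apply: (@le_trans _ _ (n%:R * d)%:E).
  rewrite -EFinM lee_fin -mulrA mulrC ler_pM2r//.
  by rewrite mulrC ler_pdivrMr ?mulr_gt0//; lra.
apply: (le_trans (count n)); apply: le_measure; rewrite ?inE.
- exact: measurableI.
- have -> : [set t | 0 <= t <= T /\ disk_ball r c rho (y t)] = `[0, T] `&` U.
    by apply/seteqP; split=> t /=; rewrite in_itv/= => -[? ]; [case|].
  exact: measurableI.
- move=> t [/=]; rewrite in_itv/= => /andP[t1 t2] Ut; split; last by split.
  by rewrite t1/=; lra.
Qed.

(** The curve is sampled at the times [b + p * n]. The isometry hypothesis makes the samples return
    near a given one with bounded gaps, and the uniform continuity at the samples turns each return
    into a stay of fixed length. *)
Lemma GRC_isometric r y (b p : R) : 0 <= r ->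
  continuous y -> (forall t, disk r (y t)) -> 0 < p ->
  (forall k m n : nat, enorm (y (b + p * (m + k)%:R) - y (b + p * (n + k)%:R))
     = enorm (y (b + p * m%:R) - y (b + p * n%:R))) ->
  (forall e, 0 < e -> exists2 d, 0 < d & forall (n : nat) s, 0 <= s <= d ->
     enorm (y (b + p * n%:R + s) - y (b + p * n%:R)) < e) ->
  forall eps, 0 < eps -> GRC r y eps.
Proof.
move=> r0 cy yr p0 iso unif eps eps0.
(* Occupation counts nonnegative times only, while [b] may be negative; the first [N] samples are
   dropped. *)
pose N := (Num.truncn (`|b| / p)).+1.
have bN : 0 <= b + p * N%:R.
  have /truncn_itv/andP[_] : 0 <= `|b| / p by rewrite divr_ge0// ltW.
  by rewrite -/N ltr_pdivrMr// mulrC; have := ler_norm (- b); rewrite normrN; lra.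
pose z n := y (b + p * (n + N)%:R).
have [M MP] : exists M, forall n, exists2 m, (n <= m <= n + M)%N
    & enorm (z m - z 0%N) < eps / 4.
  apply: (@isometric_orbit_recurrent r) => //; first by lra.
  - by move=> n; exact: yr.
  - by move=> k m n; rewrite /z !(addnAC _ k) !iso.
have [d d0 dP] := unif (eps / 4) ltac:(lra).
(* A window of [M + 1] samples contains a return, and a stay of length at most [p] after it does not
   leave the window. The radius [eps / 2] is the sum of two errors [eps / 4]: sample to [z 0], and
   curve to sample. *)
apply: (@GRC_returns r y (z 0%N) (eps / 2) eps (b + p * N%:R) (p * M.+1%:R)
  (Num.min d p)) => //.
- exact: yr.
- by lra.
- by rewrite lt_min d0.
- by rewrite mulr_gt0.
move=> n; have [m /andP[m1 m2] zm] := MP (n * M.+1)%N.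
exists (b + p * (m + N)%:R); split.
- rewrite natrD mulrDr -!addrA lerD2l addrC lerD2r -mulrA ler_pM2l//.
  by rewrite -natrM ler_nat mulnC.
- apply: (@le_trans _ _ (b + p * (m + N)%:R + p)).
    by rewrite lerD2l ge_min lexx orbT.
  rewrite -!addrA lerD2l -[X in _ + X]mulr1 -!mulrA -!mulrDr ler_pM2l//.
  rewrite -natrM -!natrD natr1 ler_nat addnC; lia.
- move=> t /andP[t1 t2].
  have -> : y t - z 0%N = (y t - z m) + (z m - z 0%N) by rewrite addrA subrK.
  apply: le_lt_trans (enormD _ _) _.
  suff : enorm (y t - z m) < eps / 4 by move: zm; lra.
  have -> : t = b + p * (m + N)%:R + (t - (b + p * (m + N)%:R)) by lra.
  apply: dP; apply/andP; split; first lra.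
  have : Num.min d p <= d by rewrite ge_min lexx.
  lra.
Qed.

End Recurrence.

(** * Generalized bicharacteristics of the disk *)

Section Billiard.
Context {R : realType}.
Implicit Types (y v : R -> R * R) (r a b s t : R) (w : R * R).

(** The third alternative of [generalized_bicharacteristic], with the incoming velocity [w] made a
    parameter. *)
Definition hyperbolic r y v t w :=
  [/\ enorm (y t) = r, (\forall s \near t^', enorm (y s) < r) &
      [/\ dot (y t) w != 0, v s @[s --> t^'-] --> w, v s @[s --> t^'+] --> v t
        & v t = w - (2 * dot (y t) w / r ^+ 2) *: y t]].

Lemma interior_derive r y v t :
  generalized_bicharacteristic r y v -> enorm (y t) < r ->
  is_derive t 1 y (v t) /\ is_derive t 1 v 0.
Proof.
move=> [_ _ _ /(_ t) [[_ ? ?]//|[yr _ _ _]|[yr _ _]]].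
- by rewrite yr ltxx.
- by rewrite yr ltxx.
Qed.

(** The velocity has zero derivative, hence is constant, on the open interval. The affine formula
    reaches the end points because [y] is continuous there, even if [v] jumps. *)
Lemma free_flight r y v a b :
  generalized_bicharacteristic r y v ->
  a < b -> (forall t, a < t < b -> enorm (y t) < r) ->
  exists w, [/\ enorm w = 1, (forall t, a < t < b -> v t = w)
    & forall t, a <= t <= b -> y t = y a + (t - a) *: w].
Proof.
move=> yv ab yr; pose m := (a + b) / 2.
have cy : continuous y by case: yv.
have vm t : a < t < b -> v t = v m.
  move=> tab; rewrite [LHS]surjective_pairing [RHS]surjective_pairing.
  congr pair.
    apply: (@derive0_cst_oo _ (fst \o v) a b) => //; last by rewrite /m; lra.
    by move=> s /yr/(interior_derive _ _ _ _ yv)[_]; exact: is_derive_comp_fst.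
  apply: (@derive0_cst_oo _ (snd \o v) a b) => //; last by rewrite /m; lra.
  by move=> s /yr/(interior_derive _ _ _ _ yv)[_]; exact: is_derive_comp_snd.
have affine (f : R -> R) (c : R) : continuous f ->
    (forall s, a < s < b -> is_derive s 1 f c) ->
    forall t, a <= t <= b -> f t = f a + (t - a) * c.
  move=> cf df t tab.
  suff : (f - c \*: id) t = (f - c \*: id) a.
    by rewrite !fctE /= /GRing.scale/= => ?; lra.
  apply: (@derive0_cst_cc _ _ a b) => //.
    apply: continuous_subspaceT => x; apply: cvgB; first exact: cf.
    by apply: cvgZr; exact: cvg_id.
  move=> s sab; have dfs := df s sab.
  by apply: is_derive_eq; rewrite [_ *: _]mulr1 subrr.
exists (v m); split => //; first by case: yv.
move=> t tab.
rewrite [LHS]surjective_pairing [RHS]surjective_pairing/=; congr pair.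
  apply: (affine (fst \o y)) => // [x|s sab].
    by apply: continuous_comp; [exact: cy|exact: cvg_fst].
  rewrite -(vm s)//; apply: is_derive_comp_fst.
  by have [] := interior_derive _ _ _ _ yv (yr _ sab).
apply: (affine (snd \o y)) => // [x|s sab].
  by apply: continuous_comp; [exact: cy|exact: cvg_snd].
rewrite -(vm s)//; apply: is_derive_comp_snd.
by have [] := interior_derive _ _ _ _ yv (yr _ sab).
Qed.

(** Without a hit, the curve would fly straight at unit speed for a time [3 * r], farther than the
    diameter [2 * r]. The first hit is the infimum of the closed set of later hits. *)
Lemma next_hit r y v a :
  0 < r -> generalized_bicharacteristic r y v ->
  (\forall s \near a^'+, enorm (y s) < r) ->
  exists b, [/\ a < b, enorm (y b) = r & forall t, a < t < b -> enorm (y t) < r].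
Proof.
move=> r_gt0 yv [d /= d0 dP].
have cy : continuous y by case: yv.
have yle t : enorm (y t) <= r by case: yv => _ /(_ t).
have dint t : a < t < a + d -> enorm (y t) < r.
  move=> /andP[at_ td]; apply: dP => //=.
  by rewrite ltr_norml; apply/andP; split; lra.
(* Searching from [c] instead of [a] discards the time [a], which may itself be spent on the
   boundary. *)
pose c := a + d / 2.
pose S := [set t | c <= t /\ enorm (y t) = r].
have cS : closed S.
  have -> : S = [set t | c <= t] `&` (fun t => enorm (y t)) @^-1` [set x | x = r].
    by [].
  apply: closedI; first exact: closed_ge.
  apply: closed_comp; last exact: closed_eq.
  move=> t _; apply: (@continuous_comp _ _ _ y (@enorm R)); first exact: cy.
  exact: continuous_enorm.
have S0 : S !=set0.
  apply: contrapT => S0.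
  have yint t : a < t < a + 3 * r + 1 -> enorm (y t) < r.
    move=> /andP[at_ tr]; have [tc|ct] := ltP t c.
      by apply: dint; move: tc; rewrite /c; lra.
    rewrite lt_neqAle yle andbT; apply/eqP => yr; apply: S0; by exists t.
  have a3 : a < a + 3 * r + 1 by lra.
  have [w [w1 _ /(_ (a + 3 * r))]] := free_flight _ _ _ _ _ yv a3 yint.
  have -> : a + 3 * r - a = 3 * r by lra.
  move=> /(_ ltac:(lra)) E.
  have : enorm ((3 * r) *: w) <= 2 * r.
    have -> : (3 * r) *: w = y (a + 3 * r) + (-1) *: y a.
      by rewrite E scaleN1r addrAC subrr add0r.
    apply: le_trans (enormD _ _) _.
    rewrite enormZ normrN1 mul1r; have := yle a; have := yle (a + 3 * r); lra.
  rewrite enormZ w1 gtr0_norm ?mulr_gt0//; lra.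
have lS : has_lbound S by exists c => t [].
have [iS1 iS2] : S (inf S).
  apply: itv_closed_infimums => //; split=> [t St|t]; first exact: ge_inf.
  by move=> tS; exact: lb_le_inf.
exists (inf S); split => //; first by move: iS1; rewrite /c; lra.
move=> t /andP[at_ tS]; have [tc|ct] := ltP t c.
  by apply: dint; move: tc; rewrite /c; lra.
rewrite lt_neqAle yle andbT; apply/eqP => yr.
by move: tS; rewrite ltNge => /negP; apply; apply: ge_inf.
Qed.

(** At a glancing time [v] is differentiable, so [v b] would be the left limit [w], which is not
    tangent. In the hyperbolic case, uniqueness of the left limit identifies the incoming velocity
    with [w]. *)
Lemma arrival r y v a b w :
  generalized_bicharacteristic r y v -> a < b -> enorm (y b) = r ->
  (forall t, a < t < b -> v t = w) -> dot (y b) w != 0 -> hyperbolic r y v b w.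
Proof.
move=> yv ab yb vw bw.
have vl : v s @[s --> b^'-] --> w.
  apply: cvg_near_cst; near=> s; apply: vw; apply/andP; split.
    by near: s; exact: nbhs_left_gt.
  by near: s; exact: nbhs_left_lt.
case: yv => _ _ _ /(_ b) [[]|[_ yvb _ [dv _]]|[_ nb [w' [w'0 w'l w'r vb]]]].
- by rewrite yb ltxx.
- have vb : v s @[s --> b^'-] --> v b.
    apply: cvg_at_left_filter.
    exact/differentiable_continuous/derivable1_diffP.
  by move: bw; rewrite (cvg_unique _ vl vb) ?yvb ?eqxx//.
- have ww' : w = w' by exact: (cvg_unique _ vl w'l).
  by split => //; rewrite ww'; split.
Unshelve. all: by end_near. Qed.

(** For a unit vector [v], the equation [|y + s v|^2 = r^2] has the roots [0] and [k], so the next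
    hit comes after time [k]. There the inner product of position and incoming velocity is [k / 2],
    hence the arrival is transversal again. *)
Lemma chord r y v a w :
  0 < r -> generalized_bicharacteristic r y v -> hyperbolic r y v a w ->
  let k := - 2 * dot (y a) (v a) in
  [/\ 0 < k, hyperbolic r y v (a + k) (v a)
    & forall t, a <= t <= a + k -> y t = y a + (t - a) *: v a].
Proof.
move=> r_gt0 yv [ya na [aw _ va _]] k.
have [|b [ab yb yint]] := next_hit _ _ _ a r_gt0 yv.
  move: na => [d /= d0 dP]; exists d => // s sd as_.
  by apply: dP => //; rewrite gt_eqF.
have [u [u1 vu yu]] := free_flight _ _ _ _ _ yv ab yint.
have uva : u = v a.
  apply: (cvg_unique _ _ va) => //; apply: cvg_near_cst; near=> s.
  apply: vu; apply/andP; split.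
    by near: s; exact: nbhs_right_gt.
  by near: s; exact: nbhs_right_lt.
have sq (p : R * R) (c : R) : enorm p = c -> p.1 ^+ 2 + p.2 ^+ 2 = c ^+ 2.
  by move=> <-; rewrite enorm_sqr.
have ybE := yu b ltac:(lra).
have bk : b = a + k.
  have := sq _ _ yb; rewrite ybE -(sq _ _ ya).
  have := sq _ _ u1; rewrite uva /k /dot !scale_pairE/= => vv E.
  apply/eqP; rewrite -subr_eq0; apply/eqP.
  have ba : b - a != 0 by rewrite subr_eq0 gt_eqF.
  apply: (mulfI ba); rewrite mulr0.
  transitivity ((b - a) ^+ 2 * (1 ^+ 2 - ((v a).1 ^+ 2 + (v a).2 ^+ 2))); last first.
    by rewrite vv subrr mulr0.
  lra.
rewrite -bk; split => //; first lra.
  rewrite -uva; apply: (arrival r y v a) => //; rewrite ybE.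
  have := sq _ _ u1.
  have -> : dot (y a + (b - a) *: u) u
    = dot (y a) u + (b - a) * (u.1 ^+ 2 + u.2 ^+ 2).
    by rewrite /dot !scale_pairE/=; ring.
  move=> ->; rewrite uva expr1n mulr1; move: bk; rewrite /k; lra.
by move=> t tab; rewrite -uva; exact: yu.
Unshelve. all: by end_near. Qed.

(** A single interior time would start a straight flight that ends in a transversal hit. So all
    times are spent on the boundary, and only the glancing alternative is left. *)
Lemma glancing_only r y v :
  0 < r -> generalized_bicharacteristic r y v ->
  (forall t w, ~ hyperbolic r y v t w) ->
  forall t, [/\ is_derive t 1 y (v t) & is_derive t 1 v (- (r ^- 2 *: y t))].
Proof.
move=> r_gt0 yv nh t; have cy : continuous y by case: yv.
have [yt|yt] := ltP (enorm (y t)) r; last first.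
  case: yv => _ _ _ /(_ t) [[]|[]//|[yr nt [w H]]].
    by rewrite ltNge yt.
  by exfalso; apply: (nh t w).
exfalso.
have [|b [tb yb yint]] := next_hit _ _ _ t r_gt0 yv.
  have L : enorm (y s) @[s --> t^'+] --> enorm (y t).
    apply: cvg_at_right_filter.
    apply: (@continuous_comp _ _ _ y (@enorm R)); first exact: cy.
    exact: continuous_enorm.
  apply: (L [set x | x < r]); exists (r - enorm (y t)) => /=.
    by rewrite subr_gt0.
  by move=> x /=; rewrite ltr_norml; lra.
have [u [u1 vu yu]] := free_flight _ _ _ _ _ yv tb yint.
apply: (nh b u); apply: (arrival r y v t) => //.
have := yu b ltac:(lra).
move: yt; rewrite enorm_lt ?ltW// -yb enorm_sqr.
have : u.1 ^+ 2 + u.2 ^+ 2 = 1 by rewrite -enorm_sqr u1 expr1n.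
move=> uu yt ybE; move: yt; rewrite ybE /dot !scale_pairE/= => yt.
(* Were the flight tangent at [b], Pythagoras would put [y t] at squared distance
   [r ^+ 2 + (b - t) ^+ 2] from the center, outside the disk. *)
apply/eqP => /(congr1 ( *%R (b - t))) E.
have : (b - t) ^+ 2 * (u.1 ^+ 2 + u.2 ^+ 2) = (b - t) ^+ 2 by rewrite uu mulr1.
have := sqr_ge0 (b - t); lra.
Qed.

End Billiard.

(** * Invariants of the billiard map, and recurrence of every geodesic *)

Section GeodesicRecurrence.
Context {R : realType}.
Implicit Types (y v : R -> R * R) (r a b s t : R) (w p : R * R).

(** Applied to position and velocity, this is the angular momentum. *)
Definition cross (p q : R * R) : R := p.1 * q.2 - p.2 * q.1.

(** The jump of the velocity is a multiple of [y t]: it reverses the radial component and has no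
    angular momentum. *)
Lemma hyperbolic_reflection r y v t w : 0 < r -> hyperbolic r y v t w ->
  dot (y t) (v t) = - dot (y t) w /\ cross (y t) (v t) = cross (y t) w.
Proof.
move=> r0 [yr _ [_ _ _ ->]].
have y2 : (y t).1 ^+ 2 + (y t).2 ^+ 2 = r ^+ 2 by rewrite -enorm_sqr yr.
have r20 : r ^+ 2 != 0 by rewrite expf_neq0// gt_eqF.
set d := dot (y t) w; rewrite scale_pairE /cross; split; last by rewrite /=; ring.
have -> : dot (y t) (w - (2 * d / r ^+ 2 * (y t).1, 2 * d / r ^+ 2 * (y t).2)) =
  d - 2 * d / r ^+ 2 * ((y t).1 ^+ 2 + (y t).2 ^+ 2) by rewrite /d /dot/=; ring.
by rewrite y2 divfK//; lra.
Qed.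

Section Bounces.
Context (r : R) (y v : R -> R * R) (a : R) (w0 : R * R).
Let c := dot (y a) (v a).
Let l := cross (y a) (v a).
Let k := - 2 * c.

(** A flight of duration [k = - 2 * c] changes the inner product from [c] to [- c], and the
    reflection changes it back; the angular momentum is kept by both. So the same [k] serves for all
    flights. *)
Lemma bounce : 0 < r -> generalized_bicharacteristic r y v ->
  hyperbolic r y v a w0 -> forall n : nat, exists w,
  [/\ hyperbolic r y v (a + k * n%:R) w,
      dot (y (a + k * n%:R)) (v (a + k * n%:R)) = c
    & cross (y (a + k * n%:R)) (v (a + k * n%:R)) = l].
Proof.
move=> r0 yv ha; elim=> [|n [w [hn dn ln]]].
  by exists w0; rewrite mulr0 addr0.
have := chord _ _ _ _ _ r0 yv hn.
have v2 : (v (a + k * n%:R)).1 ^+ 2 + (v (a + k * n%:R)).2 ^+ 2 = 1.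
  by rewrite -enorm_sqr; case: yv => _ _ -> _; rewrite expr1n.
rewrite dn -/k -(natr1 n) mulrDr mulr1 addrA.
set b := a + k * n%:R in hn dn ln v2 *; move=> /= [k0 hk yk].
exists (v b); split => //.
  rewrite (hyperbolic_reflection _ _ _ _ _ r0 hk).1 yk; last lra.
  rewrite addrAC subrr add0r scale_pairE.
  have -> : dot (y b + (k * (v b).1, k * (v b).2)) (v b) =
     dot (y b) (v b) + k * ((v b).1 ^+ 2 + (v b).2 ^+ 2) by rewrite /dot/=; ring.
  by rewrite v2 dn /k; lra.
rewrite (hyperbolic_reflection _ _ _ _ _ r0 hk).2 yk; last lra.
by rewrite addrAC subrr add0r scale_pairE -ln /cross/=; ring.
Qed.

(** In the basis made of [y] and its quarter turn [J y], the outgoing velocity is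
    [(c y + l J y) / r^2]. Hence all hits are related by one linear map, multiplication by the
    complex number [1 + j (c + i l)] with [j = k / r^2]. *)
Lemma bounce_isometric : 0 < r -> generalized_bicharacteristic r y v ->
  hyperbolic r y v a w0 -> forall m n : nat,
  enorm (y (a + k * m.+1%:R) - y (a + k * n.+1%:R)) =
  enorm (y (a + k * m%:R) - y (a + k * n%:R)).
Proof.
move=> r0 yv ha.
have r20 : r ^+ 2 != 0 by rewrite expf_neq0// gt_eqF.
have cl : c ^+ 2 + l ^+ 2 = r ^+ 2.
  have [_ _ /(_ a) v1 _] := yv; have [ya _ _] := ha.
  rewrite /c /l /dot /cross -ya enorm_sqr.
  transitivity (((y a).1 ^+ 2 + (y a).2 ^+ 2) *
    ((v a).1 ^+ 2 + (v a).2 ^+ 2)); first ring.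
  by rewrite -(enorm_sqr (v a)) v1 expr1n mulr1.
have step (n : nat) : let z := y (a + k * n%:R) in y (a + k * n.+1%:R) =
    (z.1 + k / r ^+ 2 * (c * z.1 - l * z.2),
     z.2 + k / r ^+ 2 * (c * z.2 + l * z.1)).
  have [w [hn dn ln]] := bounce r0 yv ha n.
  have := chord _ _ _ _ _ r0 yv hn.
  rewrite dn -/k -(natr1 n) mulrDr mulr1 addrA.
  have [yr _ _] := hn.
  have y2 : (y (a + k * n%:R)).1 ^+ 2 + (y (a + k * n%:R)).2 ^+ 2 = r ^+ 2.
    by rewrite -enorm_sqr yr.
  set b := a + k * n%:R in yr hn dn ln y2 *; move=> /= [k0 hk ->]; last lra.
  rewrite addrAC subrr add0r scale_pairE -dn -ln /dot /cross.
  rewrite [LHS]surjective_pairing/=; congr pair; congr (_ + _).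
    rewrite -mulrA; congr (_ * _); apply: (mulfI r20); rewrite mulVKf// -y2; ring.
  rewrite -mulrA; congr (_ * _); apply: (mulfI r20); rewrite mulVKf// -y2; ring.
move=> m n; apply/eqP; rewrite enorm_eq ?enorm_ge0// !step enorm_sqr/=; apply/eqP.
set p := y (a + k * m%:R); set q := y (a + k * n%:R).
set j := k / r ^+ 2.
(* Since [c^2 + l^2 = r^2], this says that the multiplier has modulus 1. *)
have j1 : 2 * j * c + j ^+ 2 * r ^+ 2 = 0 by rewrite /j /k; field; rewrite gt_eqF.
transitivity (((p.1 - q.1) ^+ 2 + (p.2 - q.2) ^+ 2) *
  (1 + (2 * j * c + j ^+ 2 * (c ^+ 2 + l ^+ 2)))); first ring.
by rewrite cl j1 addr0 mulr1.
Qed.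

Lemma bouncing_GRC : 0 < r -> generalized_bicharacteristic r y v ->
  hyperbolic r y v a w0 -> forall eps, 0 < eps -> GRC r y eps.
Proof.
move=> r0 yv ha; have [cy yr v1 _] := yv.
have [k0 _ _] := chord _ _ _ _ _ r0 yv ha.
apply: (@GRC_isometric R r y a k (ltW r0) cy yr k0) => [j m n|e e0].
  elim: j => [|j IH]; first by rewrite !addn0.
  by rewrite !addnS bounce_isometric.
(* The speed is 1, so the displacement after time [s] is [s]; the bound by [k] keeps the curve on
   one chord. *)
exists (Num.min (e / 2) k); first by rewrite lt_min k0 divr_gt0.
move=> n s /andP[s0]; rewrite le_min => /andP[se sk].
have [w [hn dn ln]] := bounce r0 yv ha n.
have [_ _ ->] := chord _ _ _ _ _ r0 yv hn; last by rewrite dn -/k; lra.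
by rewrite addrAC subrr add0r addrAC subrr add0r enormZ v1 mulr1 ger0_norm//; lra.
Qed.

End Bounces.

(** Each coordinate is a harmonic oscillator of frequency [1 / r]. Instead of solving the equation,
    the proof uses a conserved quantity [F] that equals [f] at both times, when the phase [u] is [0]
    and [2 * pi]. *)
Lemma gliding_periodic r y v : 0 < r ->
  (forall t, is_derive t 1 y (v t)) ->
  (forall t, is_derive t 1 v (- (r ^- 2 *: y t))) ->
  forall t, y (t + 2 * pi * r) = y t.
Proof.
move=> r0 dy dv t.
have rN0 : r != 0 by rewrite gt_eqF.
have oscillator (f g : R -> R) : (forall s, is_derive s 1 f (g s)) ->
    (forall s, is_derive s 1 g (- (r ^- 2 * f s))) -> f (t + 2 * pi * r) = f t.
  move=> df dg.
  pose u := (r^-1 \*: (id - cst t)) : R -> R.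
  pose F := (cos \o u) * f - r \*: ((sin \o u) * g).
  have uE s : u s = r^-1 * (s - t) by [].
  have /is_derive_0_is_cst F0 s : is_derive s 1 F 0.
    have du : is_derive s 1 u r^-1.
      by apply: is_derive_eq; rewrite subr0 [_ *: _]mulr1.
    have dfs := df s; have dgs := dg s.
    apply: is_derive_eq; rewrite /GRing.scale/= /GRing.scale/=.
    by field.
  have FE s : F s = cos (u s) * f s - r * (sin (u s) * g s) by [].
  have := F0 (t + 2 * pi * r) t; rewrite !FE !uE subrr mulr0 cos0 sin0.
  have -> : r^-1 * (t + 2 * pi * r - t) = 0 + pi *+ 2 by field.
  by rewrite cosD2pi sinD2pi cos0 sin0; lra.
rewrite [LHS]surjective_pairing [RHS]surjective_pairing; congr pair.
  apply: (oscillator (fst \o y) (fst \o v)) => s; first exact: is_derive_comp_fst.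
  exact: (is_derive_comp_fst _ _ _ (dv s)).
apply: (oscillator (snd \o y) (snd \o v)) => s; first exact: is_derive_comp_snd.
exact: (is_derive_comp_snd _ _ _ (dv s)).
Qed.

(** Sampled once per period the orbit is constant, so the isometry hypothesis is trivial and
    continuity at time 0 is uniform over all samples. *)
Lemma periodic_GRC r y (P : R) : 0 <= r -> continuous y ->
  (forall t, disk r (y t)) -> 0 < P -> (forall t, y (t + P) = y t) ->
  forall eps, 0 < eps -> GRC r y eps.
Proof.
move=> r0 cy yr P0 yP.
have yPn (n : nat) t : y (t + P * n%:R) = y t.
  elim: n => [|n IH]; first by rewrite mulr0 addr0.
  by rewrite -(natr1 n) mulrDr mulr1 addrA yP.
apply: (@GRC_isometric R r y 0 P) => // [k m n|e e0]; first by rewrite !yPn.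
have : enorm (y s - y 0) @[s --> 0] --> enorm (y 0 - y 0).
  apply: (@cvg_comp _ _ _ (fun s => y s - y 0)); last exact: continuous_enorm.
  by apply: cvgB; [exact: cy|exact: cvg_cst].
rewrite subrr (_ : enorm 0 = 0); last first.
  by rewrite /enorm /dot mulr0 addr0 sqrtr0.
move=> /(_ [set x | x < e])[].
  by exists e => //= x /=; rewrite sub0r normrN ltr_norml => /andP[].
move=> d /= d0 dP; exists (d / 2); first by rewrite divr_gt0.
move=> n s /andP[s0 sd]; rewrite addrAC yPn yPn add0r; apply: dP => /=.
by rewrite sub0r normrN ger0_norm//; lra.
Qed.

Lemma geodesic_GRC r y : 0 < r -> generalized_geodesic r y ->
  forall eps, 0 < eps -> GRC r y eps.
Proof.
move=> r0 [v yv]; have [cy yr _ _] := yv.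
have [[a [w ha]]|nh] := pselect (exists a w, hyperbolic r y v a w).
  exact: (bouncing_GRC _ _ _ _ _ r0 yv ha).
have yv' t : is_derive t 1 y (v t) /\ is_derive t 1 v (- (r ^- 2 *: y t)).
  by apply: glancing_only => // s w hs; apply: nh; exists s, w.
apply: (@periodic_GRC r y (2 * pi * r) (ltW r0)) => //.
  by rewrite !mulr_gt0 ?pi_gt0.
by apply: (gliding_periodic _ _ v) => // t; have [] := yv' t.
Qed.

End GeodesicRecurrence.

(** * A chord with irrational rotation angle *)

Section IrrationalBilliard.
Context {R : realType}.
Implicit Types (r s t x : R) (p q : R * R) (n : int).

Definition rot x p : R * R :=
  (cos x * p.1 - sin x * p.2, sin x * p.1 + cos x * p.2).

Lemma rotD x x' p : rot (x + x') p = rot x (rot x' p).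
Proof. by rewrite /rot cosD sinD/=; congr pair; ring. Qed.

Lemma rot_add x p q : rot x (p + q) = rot x p + rot x q.
Proof. by rewrite /rot/=; congr pair => /=; ring. Qed.

Lemma rot_scale x t p : rot x (t *: p) = t *: rot x p.
Proof. by rewrite !scale_pairE /rot/=; congr pair; ring. Qed.

Lemma dot_rot x p q : dot (rot x p) (rot x q) = dot p q.
Proof.
rewrite /dot /rot/=.
transitivity ((cos x ^+ 2 + sin x ^+ 2) * (p.1 * q.1 + p.2 * q.2)); first ring.
by rewrite cos2Dsin2 mul1r.
Qed.

Lemma enorm_rot x p : enorm (rot x p) = enorm p.
Proof. by rewrite /enorm dot_rot. Qed.

(** The central angle subtended by a chord at distance [4 / 5 * r] from the center. *)
Definition angle : R := 2 * acos (4 / 5).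

Lemma cos_angle : cos angle = 7 / 25.
Proof.
by rewrite /angle mulr_natl cos_mulr2n acosK ?in_itv/=; [field|lra].
Qed.

Lemma sin_angle : sin angle = 24 / 25.
Proof.
rewrite /angle mulr_natl sin_mulr2n acosK ?in_itv/=; last lra.
rewrite sin_acos; last lra.
have -> : 1 - (4 / 5) ^+ 2 = (3 / 5) ^+ 2 :> R by field.
by rewrite sqrtr_sqr ger0_norm; [field|lra].
Qed.

(* (7 + 24 i) ^ n is congruent to (2 + 4 i) or - (2 + 4 i) modulo 5, so that
   its imaginary part does not vanish. *)
Lemma sin_angle_neq0 (n : nat) : sin (angle *+ n.+1) != 0.
Proof.
have [k [j [e [e1 _ E]]]] : exists k j e : int, [/\ e = 1 \/ e = -1,
    cos (angle *+ n.+1) * 25 ^+ n.+1 = (5 * k + 2 * e)%:~R &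
    sin (angle *+ n.+1) * 25 ^+ n.+1 = (5 * j + 4 * e)%:~R].
  elim: n => [|n [k [j [e [e1 ck sj]]]]].
    exists 1, 4, 1; rewrite mulr1n cos_angle sin_angle expr1; split; first by left.
      by rewrite mulfVK.
    by rewrite mulfVK.
  exists (7 * k - 24 * j - 16 * e), (24 * k + 7 * j + 16 * e), (- e).
  rewrite mulrS cosD sinD cos_angle sin_angle exprS; split; first lia.
    transitivity (7 * (cos (angle *+ n.+1) * 25 ^+ n.+1)
      - 24 * (sin (angle *+ n.+1) * 25 ^+ n.+1)); first by field.
    by rewrite ck sj; ring.
  transitivity (24 * (cos (angle *+ n.+1) * 25 ^+ n.+1)
      + 7 * (sin (angle *+ n.+1) * 25 ^+ n.+1)); first by field.
  by rewrite ck sj; ring.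
apply/eqP => s0; move: E; rewrite s0 mul0r => /esym/eqP; rewrite intr_eq0 => /eqP.
lia.
Qed.

(** The length of the chord, twice [3 / 5 * r]: the time between hits, not a period of the curve. *)
Definition period r : R := 6 / 5 * r.
Lemma period_gt0 r : 0 < r -> 0 < period r.
Proof. by move=> r0; rewrite mulr_gt0// divr_gt0. Qed.

(** The floor assigns a hit time to the lap that it opens, so that [velocity] is the outgoing one
    there. *)
Definition lap r t : int := Num.floor (t / period r).
(** The whole line carrying the chord, for all [t], so that consecutive lines can be compared at the
    hit they share. *)
Definition segment r n t : R * R :=
  rot (angle * n%:~R) (4 / 5 * r, t - period r * n%:~R - 3 / 5 * r).
Definition direction n : R * R := rot (angle * n%:~R) (0, 1).
Definition trajectory r t : R * R := segment r (lap r t) t.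
Definition velocity r t : R * R := direction (lap r t).

Lemma lapP r t : 0 < r ->
  period r * (lap r t)%:~R <= t < period r * (lap r t + 1)%:~R.
Proof.
move=> r0; have P0 := period_gt0 r r0.
by have := floor_itv (t / period r);
  rewrite ler_pdivlMr// ltr_pdivrMr// ![_ * period r]mulrC.
Qed.

Lemma lap_eq r n t : 0 < r ->
  period r * n%:~R <= t < period r * (n + 1)%:~R -> lap r t = n.
Proof.
move=> r0 tn; have P0 := period_gt0 r r0.
by apply: floor_def; rewrite ler_pdivlMr// ltr_pdivrMr// ![_ * period r]mulrC.
Qed.

Lemma segment_affine r n s t :
  segment r n t = segment r n s + (t - s) *: direction n.
Proof.
rewrite /segment /direction -rot_scale -rot_add; congr rot.
by rewrite [RHS]surjective_pairing scale_pairE/=; congr pair; ring.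
Qed.

(** The rotation by [angle] takes the lower end [(4/5 r, - 3/5 r)] of the vertical chord to its
    upper end. *)
Lemma segment_junction r n t : t = period r * (n + 1)%:~R ->
  segment r (n + 1) t = segment r n t.
Proof.
move=> ->; rewrite /segment subrr intrD mulr1z !mulrDr !mulr1 rotD; congr rot.
by rewrite /rot cos_angle sin_angle /period/=; congr pair; field.
Qed.

(** The power of a point with respect to the circle: the product of the signed distances to the two
    ends of the chord. *)
Lemma segment_sqr r n t : 0 < r ->
  (segment r n t).1 ^+ 2 + (segment r n t).2 ^+ 2 =
  r ^+ 2 + (t - period r * n%:~R) * (t - period r * (n + 1)%:~R).
Proof.
move=> r0; rewrite -enorm_sqr enorm_rot enorm_sqr/= intrD mulr1z !mulrDr !mulr1.
rewrite /period.
by field.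
Qed.

Lemma trajectory_eq r n t : 0 < r ->
  period r * n%:~R <= t <= period r * (n + 1)%:~R ->
  trajectory r t = segment r n t.
Proof.
move=> r0 /andP[nt]; rewrite le_eqVlt => /predU1P[tE|tn]; last first.
  by rewrite /trajectory (lap_eq _ n)// nt.
rewrite /trajectory (lap_eq _ (n + 1)) ?segment_junction//.
by rewrite tE lexx/= ltr_pM2l ?period_gt0// ltr_int ltzD1.
Qed.

Lemma is_derive_affine (p q : R * R) s t :
  is_derive t 1 (fun x => p + (x - s) *: q) q.
Proof.
have L : h^-1 *: (((fun x => p + (x - s) *: q) \o shift t) (h *: 1)
    - (p + (t - s) *: q)) @[h --> (0 : R)^'] --> q.
  apply: cvg_near_cst; near=> h.
  have h0 : h != 0 by near: h; exact: nbhs_dnbhs_neq.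
  rewrite /= [h *: 1]mulr1 opprD addrACA subrr add0r -scalerBl scalerA.
  by rewrite (_ : h^-1 * _ = 1) ?scale1r//; field.
by split; [apply/cvg_ex; exists q|exact: cvg_lim L].
Unshelve. all: by end_near. Qed.

Lemma continuous_segment r n : continuous (segment r n).
Proof.
move=> t; have -> : segment r n = fun x => segment r n t + (x - t) *: direction n.
  by apply/funext => x; exact: segment_affine.
have [+ _] := is_derive_affine (segment r n t) (direction n) t t.
by move=> /derivable1_diffP/differentiable_continuous.
Qed.

Lemma near_left_lap r n : 0 < r ->
  \forall s \near (period r * (n + 1)%:~R)^'-,
    period r * n%:~R < s < period r * (n + 1)%:~R.
Proof.
move=> r0; have P0 := period_gt0 _ r0.
near=> s; apply/andP; split; last by near: s; exact: nbhs_left_lt.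
by near: s; apply: nbhs_left_gt; rewrite ltr_pM2l// ltr_int ltzD1.
Unshelve. all: by end_near. Qed.

Lemma near_right_lap r n : 0 < r ->
  \forall s \near (period r * n%:~R)^'+,
    period r * n%:~R < s < period r * (n + 1)%:~R.
Proof.
move=> r0; have P0 := period_gt0 _ r0.
near=> s; apply/andP; split; first by near: s; exact: nbhs_right_gt.
by near: s; apply: nbhs_right_lt; rewrite ltr_pM2l// ltr_int ltzD1.
Unshelve. all: by end_near. Qed.

Lemma near_lap r n t : 0 < r ->
  period r * n%:~R < t < period r * (n + 1)%:~R ->
  \forall s \near t, period r * n%:~R < s < period r * (n + 1)%:~R.
Proof.
move=> r0 /andP[nt tn]; near=> s; apply/andP; split; near: s.
  exact: lt_nbhsr.
exact: lt_nbhsl.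
Unshelve. all: by end_near. Qed.

End IrrationalBilliard.

(** * The chord trajectory as a geodesic that is neither periodic nor uniformly distributed *)

Section NoDichotomy.
Context {R : realType}.
Implicit Types (r s t x : R) (p q : R * R) (n : int).

Lemma trajectory_interior r n t : 0 < r ->
  period r * n%:~R < t < period r * (n + 1)%:~R -> enorm (trajectory r t) < r.
Proof.
move=> r0 /andP[nt tn]; rewrite (trajectory_eq _ n)// ?(ltW nt) ?(ltW tn)//.
rewrite enorm_lt ?ltW// segment_sqr// gtrDl pmulr_rlt0 ?subr_gt0//.
by rewrite subr_lt0.
Qed.

Lemma trajectory_boundary r n : 0 < r ->
  enorm (trajectory r (period r * n%:~R)) = r.
Proof.
move=> r0; rewrite (trajectory_eq _ n)//; last first.
  by rewrite lexx/= ler_pM2l ?period_gt0// ler_int lerDl.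
by apply/eqP; rewrite enorm_eq ?ltW// segment_sqr// subrr mul0r addr0.
Qed.

(** Hit times are written with [n + 1] so that [n] indexes the incoming chord and [n + 1] the
    outgoing one. *)
Lemma lap_cases r t : 0 < r ->
  (exists n, t = period r * (n + 1)%:~R) \/
  (exists n, period r * n%:~R < t < period r * (n + 1)%:~R).
Proof.
move=> r0; have /andP[+ tn] := lapP r t r0.
rewrite le_eqVlt => /predU1P[nt|nt]; [left|right].
  by exists (lap r t - 1); rewrite subrK.
by exists (lap r t); rewrite nt.
Qed.

Lemma near_trajectory_interior r n t : 0 < r ->
  period r * n%:~R < t < period r * (n + 1)%:~R ->
  \forall s \near t, segment r n s = trajectory r s.
Proof.
move=> r0 nt; near=> s.
have /andP[s1 s2] : period r * n%:~R < s < period r * (n + 1)%:~R.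
  by near: s; exact: near_lap.
by rewrite (trajectory_eq _ n)// (ltW s1) ltW.
Unshelve. all: by end_near. Qed.

Lemma continuous_trajectory r : 0 < r -> continuous (trajectory r).
Proof.
move=> r0 t; have P0 := period_gt0 r r0.
have [[n tn]|[n nt]] := lap_cases r t r0; last first.
  have near_y := near_trajectory_interior _ _ _ r0 nt.
  rewrite /continuous_at -(nbhs_singleton near_y).
  exact/(cvg_trans (near_eq_cvg near_y))/continuous_segment.
have yn : trajectory r t = segment r n t.
  by apply: trajectory_eq; rewrite // tn lexx andbT ler_pM2l// ler_int lerDl.
have yn1 : trajectory r t = segment r (n + 1) t by rewrite segment_junction.
apply/cvgrPdist_lt => e e0; near=> s.
have sn : period r * n%:~R < s.
  by near: s; apply: lt_nbhsr; rewrite tn ltr_pM2l// ltr_int ltzD1.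
have sn2 : s < period r * (n + 1 + 1)%:~R.
  by near: s; apply: lt_nbhsl; rewrite tn ltr_pM2l// ltr_int ltzD1.
have [st|ts] := leP s t.
  rewrite yn (trajectory_eq _ n)//; last by rewrite ltW//= -tn.
  near: s; move/cvgrPdist_lt: (continuous_segment r n t); exact.
rewrite yn1 (trajectory_eq _ (n + 1))//; last by rewrite -tn !ltW.
near: s; move/cvgrPdist_lt: (continuous_segment r (n + 1) t); exact.
Unshelve. all: by end_near. Qed.

Lemma trajectory_geodesic r : 0 < r -> generalized_geodesic r (trajectory r).
Proof.
move=> r0; exists (velocity r).
have P0 := period_gt0 r r0.
have boundary n : enorm (trajectory r (period r * n%:~R)) = r.
  exact: trajectory_boundary.
split => [|t|t|t].
- exact: continuous_trajectory.
- rewrite /disk/=; have [[n ->]|[n nt]] := lap_cases r t r0.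
    by rewrite boundary.
  by rewrite ltW// (trajectory_interior _ n).
- rewrite /velocity /direction enorm_rot; apply/eqP.
  by rewrite enorm_eq//= expr0n expr1n add0r.
have [[n tn]|[n nt]] := lap_cases r t r0; last first.
  have lapn s : period r * n%:~R < s < period r * (n + 1)%:~R -> lap r s = n.
    by move=> /andP[s1 s2]; apply: lap_eq; rewrite // ltW.
  apply: Or31; split; first exact: (trajectory_interior _ n).
    apply: near_eq_is_derive (near_trajectory_interior _ _ _ r0 nt) _.
    rewrite /velocity lapn// (_ : segment r n = fun x =>
      segment r n t + (x - t) *: direction n); first exact: is_derive_affine.
    by apply/funext => x; exact: segment_affine.
  apply: (@near_eq_is_derive _ _ _ (cst (direction n))).
    near=> s; rewrite /velocity lapn//.
    by near: s; exact: near_lap.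
have lapn s : period r * n%:~R < s < period r * (n + 1)%:~R -> lap r s = n.
  by move=> /andP[s1 s2]; apply: lap_eq; rewrite // ltW.
have lapn1 s : period r * (n + 1)%:~R < s < period r * (n + 1 + 1)%:~R ->
    lap r s = n + 1.
  by move=> /andP[s1 s2]; apply: lap_eq; rewrite // ltW.
have laptn : lap r t = n + 1.
  by apply: lap_eq; rewrite // tn lexx/= ltr_pM2l// ltr_int ltzD1.
have vt : velocity r t = direction (n + 1) by rewrite /velocity laptn.
have yt : trajectory r t = rot (angle * n%:~R) (4 / 5 * r, 3 / 5 * r).
  rewrite (trajectory_eq _ n)//; last first.
    by rewrite tn lexx andbT ler_pM2l// ler_int lerDl.
  rewrite /segment tn; congr rot; congr pair.
  by rewrite intrD mulr1z /period; field.
have dn : dot (trajectory r t) (direction n) = 3 / 5 * r.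
  by rewrite yt dot_rot /dot/= mulr0 add0r mulr1.
apply: Or33; split.
- by rewrite tn boundary.
- have tnn : period r * n%:~R < t < period r * (n + 1 + 1)%:~R.
    by rewrite tn !ltr_pM2l// !ltr_int; lia.
  rewrite near_withinE; near=> s => st.
  have [{}st|ts|sE] := ltgtP s t; last by rewrite sE eqxx in st.
    apply: (trajectory_interior _ n) => //; rewrite -tn st andbT.
    by near: s; apply: lt_nbhsr; case/andP: tnn.
  apply: (trajectory_interior _ (n + 1)) => //; rewrite -tn ts/=.
  by near: s; apply: lt_nbhsl; case/andP: tnn.
exists (direction n); split.
- by rewrite dn !mulf_neq0// ?gt_eqF ?invr_gt0.
- apply: cvg_near_cst; rewrite tn; near=> s; rewrite /velocity lapn//.
  by near: s; exact: near_left_lap.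
- rewrite vt; apply: cvg_near_cst; rewrite tn; near=> s; rewrite /velocity lapn1//.
  by near: s; exact: near_right_lap.
(* The common rotation by [angle * n] is factored out; it remains to reflect [(0, 1)] at the point
   [(4/5 r, 3/5 r)], which gives [(- 24/25, 7/25)], its rotation by [angle]. *)
- rewrite vt dn yt /direction intrD mulr1z mulrDr mulr1 rotD -rot_scale.
  rewrite -[- rot _ _]scaleN1r -rot_scale -rot_add; congr rot.
  rewrite /rot cos_angle sin_angle [RHS]surjective_pairing !scale_pairE/=.
  by congr pair; field; rewrite gt_eqF.
Unshelve. all: by end_near. Qed.

(** The curve starts on the boundary, so a period is a hit time, and a positive multiple of [angle]
    would fix the starting point; its sine would then vanish. *)
Lemma trajectory_not_periodic r : 0 < r -> ~ periodic_curve (trajectory r).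
Proof.
move=> r0 [Q Q0 /(_ 0)]; rewrite add0r => yQ.
have P0 := period_gt0 r r0.
have y0 : trajectory r 0 = (4 / 5 * r, - (3 / 5 * r)).
  rewrite (trajectory_eq _ 0) ?mulr0 ?lexx ?add0r ?mulr1z ?mulr1 ?ltW//.
  by rewrite /segment /rot !mulr0 cos0 sin0/= subrr !sub0r !mul0r !mul1r subr0 add0r.
have [[n Qn]|[n nt]] := lap_cases r Q r0; last first.
  have := trajectory_interior _ _ _ r0 nt.
  by rewrite yQ -(mulr0 (period r)) -[0]/(0%:~R) trajectory_boundary// ltxx.
have : 0 < n + 1 by rewrite -(ltr_int R) -(pmulr_rgt0 _ P0) -Qn.
case: (n + 1) Qn => [[|m]|m]// Qn _.
have := yQ; rewrite y0 Qn (trajectory_eq _ m.+1)//; last first.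
  by rewrite lexx/= ler_pM2l// ler_int lerDl.
rewrite /segment subrr sub0r => -[].
rewrite -[m.+1%:~R]/(m.+1%:R) mulr_natr => E1 E2.
have /eqP := @sin_angle_neq0 R m; apply.
apply: (mulIf (_ : r != 0)); first by rewrite gt_eqF.
(* The combination [3/5 E1 + 4/5 E2] eliminates the cosine and leaves [s * r = 0]. *)
rewrite mul0r; move: E1 E2; set c := cos _; set s := sin _; lra.
Qed.

Lemma trajectory_far r t : 0 < r ->
  (4 / 5 * r) ^+ 2 <= (trajectory r t).1 ^+ 2 + (trajectory r t).2 ^+ 2.
Proof.
by move=> r0; rewrite -enorm_sqr enorm_rot enorm_sqr/= lerDl sqr_ge0.
Qed.

(** Serves as the test set, for [x = r / 2], and as an outer bound of the disk, for [x = 2 * r]; its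
    area is a plain product. *)
Definition square x : set (R * R) := `]- x, x[ `*` `]- x, x[.

Lemma area_square x : 0 < x -> area (square x) = ((2 * x) ^+ 2)%:E.
Proof.
move=> x0; rewrite /area product_measure1E//=.
have -> : lebesgue_measure (`]- x, x[%classic : set R) = (2 * x)%:E.
  rewrite lebesgue_measure_itv/= lte_fin gtrN// -EFinD; congr EFin; lra.
by rewrite -EFinM expr2.
Qed.

Lemma open_square x : open (square x).
Proof.
have -> : square x =
  fst @^-1` `]- x, x[%classic `&` snd @^-1` `]- x, x[%classic by [].
apply: openI; apply: open_comp => [p _|].
- exact: cvg_fst.
- exact: itv_open.
- exact: cvg_snd.
- exact: itv_open.
Qed.

Lemma measurable_disk r : 0 <= r ->
  measurable (disk r : set (measurableTypeR R * measurableTypeR R)).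
Proof.
move=> r0.
pose f (p : measurableTypeR R * measurableTypeR R) := p.1 ^+ 2 + p.2 ^+ 2.
have -> : disk r = f @^-1` [set` `]-oo, r ^+ 2]].
  by apply/seteqP; split=> p; rewrite /disk/= enorm_le// in_itv.
rewrite -[_ @^-1` _]setTI.
suff : measurable_fun setT f by apply.
by apply: measurable_funD; apply: measurable_funX.
Qed.

(** The occupation of the test square is identically 0, whereas the ratio of areas is positive: the
    inner and outer squares show that the disk has positive and finite area. *)
Lemma trajectory_not_uniformly_distributed r : 0 < r ->
  ~ uniformly_distributed r (trajectory r).
Proof.
move=> r0 /(_ (square (r / 2))).
(* Points of the test square have squared norm below [r^2 / 2], which is less than the [16/25 r^2]
   that the trajectory keeps. *)
have sqr_lt_half (x : R) : - (r / 2) < x < r / 2 -> x ^+ 2 < r ^+ 2 / 4.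
  by move=> /andP[x1 x2]; nra.
have sub : square (r / 2) `<=` disk r.
  move=> [a b] []; rewrite /= !in_itv/= => /sqr_lt_half a2 /sqr_lt_half b2.
  by rewrite /disk/= enorm_le ?(ltW r0)//=; have := sqr_ge0 r; lra.
have sup : disk r `<=` square (2 * r).
  move=> [a b]; rewrite /disk/= enorm_le ?(ltW r0)//= => ab.
  by split; rewrite /= in_itv/=; apply/andP; split; nra.
have ms x : measurable (square x : set (measurableTypeR R * measurableTypeR R)).
  exact: measurableX.
have a1 : (area (square (r / 2)) <= area (disk r))%E.
  by apply: le_measure; rewrite ?inE//; apply: measurable_disk; exact: ltW.
have a2 : (area (disk r) <= area (square (2 * r)))%E.
  by apply: le_measure; rewrite ?inE//; apply: measurable_disk; exact: ltW.
have -> : occupation (trajectory r) (square (r / 2)) = cst 0%E.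
  apply/funext => T; rewrite /occupation (_ : [set t | _] = set0) ?measure0 ?mul0e//.
  rewrite -subset0 => t [_]; have := trajectory_far r t r0.
  case: (trajectory r t) => a b + []; rewrite /= !in_itv/=.
  move=> ab /sqr_lt_half ? /sqr_lt_half ?; have := exprn_gt0 2 r0; lra.
move=> H; have {H}/H : disk_open r (square (r / 2)).
  by exists (square (r / 2)); [exact: open_square|rewrite setIidr].
move=> /(cvg_unique _ (cvg_cst _)) => /(_ (@ereal_hausdorff R)).
rewrite area_square ?divr_gt0//; move: a1 a2.
rewrite !area_square ?divr_gt0 ?mulr_gt0//.
case: (area (disk r)) => [d|//|//]; rewrite !lee_fin => d1 _.
have s0 : 0 < (2 * (r / 2)) ^+ 2 by rewrite exprn_gt0// mulr_gt0// divr_gt0.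
have d0 : 0 < d by exact: lt_le_trans d1.
rewrite inver gt_eqF// -EFinM => -[] /esym/eqP.
by rewrite gt_eqF// divr_gt0.
Qed.

End NoDichotomy.

Theorem proposition2 (R : realType) (r : R) (r_gt0 : 0 < r) :
  (forall y : R -> R * R, generalized_geodesic r y ->
     forall eps : R, 0 < eps -> GRC r y eps) /\
  ~ dichotomy r.
Proof.
split=> [y|dich]; first exact: geodesic_GRC.
have [] := dich _ (trajectory_geodesic _ r_gt0).
  exact: trajectory_not_periodic.
exact: trajectory_not_uniformly_distributed.
Qed.
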